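(* For all $n\ge 1$, the number $cs(n,2)$ of complete simple games (up to isomorphism) with $n$ voters and exactly $t=2$ equivalence classes of voters is $$cs(n,2)=Fibonacci(n+6)-\left(n^2+4n+8\right),$$ where $Fibonacci(0)=0$, $Fibonacci(1)=1$, and $Fibonacci(i)=Fibonacci(i-1)+Fibonacci(i-2)$ for $i\ge 2$.
   Context: Let $N=\{1,\dots,n\}$ be a set of $n$ voters. A simple game is a pair $(N,\chi)$ with $\chi:2^N\to\{0,1\}$, $\chi(\emptyset)=0$, $\chi(N)=1$, and $\chi(U')\le\chi(U)$ whenever $U'\subseteq U\subseteq N$. For voters $i,j$ write $i\sqsupset j$ if $\chi(\{i\}\cup U\setminus\{j\})\le\chi(U)$ for all $U$ with $\{j\}\subseteq U\subseteq N\setminus\{i\}$ ($i$ is at most as desirable as $j$). The game is a complete simple game if $\sqsupset$ is a total preorder on $N$. Voters $i,j$ are equivalent if $i\sqsupset j$ and $j\sqsupset i$; the equivalence classes of voters are the classes of this relation. Two complete simple games $(N_1,\chi_1)$, $(N_2,\chi_2)$ are isomorphic if there is a bijection $\varphi:N_1\to N_2$ of the voter sets with $\chi_1(U)=\chi_2(\varphi(U))$ for all $U\subseteq N_1$. $cs(n,t)$ is the number of isomorphism classes of complete simple games with $n$ voters and exactly $t$ equivalence classes of voters. *)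

(* Defs.v *)
From mathcomp Require Import all_boot all_order all_fingroup all_algebra.

Set Implicit Arguments.
Unset Strict Implicit.
Unset Printing Implicit Defensive.

(* A game on the voter set T is given by its characteristic function chi; the
   inequalities between its values are those of nat, through bool >-> nat. *)
Definition game (T : finType) := {ffun {set T} -> bool}.

Definition simple_game (T : finType) (chi : game T) : bool :=
  [&& chi set0 == false, chi [set: T] == true
    & [forall U' : {set T}, forall U : {set T},
        (U' \subset U) ==> (chi U' <= chi U)]].

(* i is at most as desirable as j.  For i = j there is no U to consider, so
   the relation is reflexive. *)
Definition at_most_desirable (T : finType) (chi : game T) (i j : T) : bool :=
  [forall U : {set T},
    ([set j] \subset U) && (U \subset [set~ i]) ==>
      (chi (i |: (U :\ j)) <= chi U)].

Definition total_preorder (T : finType) (r : rel T) : bool :=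
  [&& [forall i, r i i],
      [forall i, forall j, forall k, r i j ==> r j k ==> r i k]
    & [forall i, forall j, r i j || r j i]].

Definition complete_simple_game (T : finType) (chi : game T) : bool :=
  simple_game chi && total_preorder (at_most_desirable chi).

Definition equivalent_voters (T : finType) (chi : game T) (i j : T) : bool :=
  at_most_desirable chi i j && at_most_desirable chi j i.

Definition voter_classes (T : finType) (chi : game T) : {set {set T}} :=
  equivalence_partition (equivalent_voters chi) [set: T].

Definition isomorphic_games (T : finType) (chi1 chi2 : game T) : bool :=
  [exists phi : {perm T}, forall U : {set T}, chi1 U == chi2 (phi @: U)].

(* Every game with n voters is isomorphic to one with voter set 'I_n, so the
   isomorphism classes are counted among the games on 'I_n. *)
Definition cs (n t : nat) : nat :=
  #|equivalence_partition (@isomorphic_games 'I_n)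
      [set chi : game 'I_n | complete_simple_game chi & #|voter_classes chi| == t]|.

Fixpoint Fibonacci (i : nat) : nat :=
  match i with
  | 0 => 0
  | 1 => 1
  | (k.+1 as j).+1 => Fibonacci j + Fibonacci k
  end.

(* Main.v *)
Require Import Defs.
From mathcomp Require Import all_boot all_order all_fingroup all_algebra.
From mathcomp Require Import zify.

(** In a complete simple game with two classes, let [A] be the class of the more
    desirable voters, [k] its size, and [j] the number of the other voters.
    Whether a coalition wins depends only on the numbers [a] and [b] of its
    strong and weak members, and winning is preserved when [a] does not
    decrease and [a + b] does not decrease ([dominated_win], an exchange
    argument).  So the game is encoded by its profile
    [s_0, ..., s_k], where [s_a] is the least [b] that makes [a] strong voters
    win, and [s_a = j + 1] if there is none.  Monotonicity says exactly that
    [s] repeats [j + 1] some number of times, then decreases strictly through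
    values in [1, ..., j], then repeats [0].  The two classes are really distinct
    exactly when some drop [s_a - s_(a + 1)] is at least [2]: such a drop gives
    a coalition in which a strong voter cannot be replaced by a weak one.  Since
    [A] is determined by the game alone, isomorphisms preserve it and hence the
    code [(k, s)] ([code_game_inj]); every such game is isomorphic to the game
    of a code ([code_game_surj]), so that codes count the isomorphism classes
    ([cs2_codes]).

    For the counting, let [B m j] be the number of profiles of length [m] with
    parameter [j].  It satisfies Pascal's rule
    [B (m + 1) (j + 1) = B (m + 1) j + B m j], because deleting a value of the
    strictly decreasing part shortens it by one; hence its antidiagonal sums
    follow the Fibonacci recursion up to an affine term and equal
    [Fibonacci (N + 5) - (N + 4)] ([sum_size_profiles]).  Profiles all of whose
    drops are at most [1] come from the games where only the size of a coalition
    matters; for [k + j = n] there are [n + 2] of them, one for each threshold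
    between [0] and [n + 1].  Summing [B (k + 1) (n - k) - (n + 2)] over
    [0 <= k <= n] gives
    [Fibonacci (n + 6) - (n + 5) - 1 - (n + 1) (n + 2)], the announced value.
    The cases [k = 0] and [k = n] contribute nothing, but including them makes
    the sum a full antidiagonal up to the term [B 0 (n + 1) = 1]. *)

Set Implicit Arguments.
Unset Strict Implicit.
Unset Printing Implicit Defensive.

(** * Profiles and their enumeration *)

(** One inequality for three rules: from [j.+1] a profile may go anywhere below
    or stay, from a value in [1..j] it must decrease, and from [0] it stays. *)
Definition step (j u w : nat) : bool := w <= u - (u <= j).

(** Starting the path at [j.+1] bounds the first entry and constrains nothing
    else, since [step] is unconstrained below [j.+1]. *)
Definition profile (m j : nat) (s : seq nat) : bool :=
  (size s == m) && path (step j) j.+1 s.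

Definition small_drop (u w : nat) : bool := u <= w.+1.

(** The ways to continue a profile by [m] entries once an entry [v <= j] has been
    reached; they no longer depend on [j].  For [v = j.+1] these are the ways
    to leave [j.+1] at once. *)
Fixpoint drops (m v : nat) : seq (seq nat) :=
  if m is m'.+1 then [seq u :: s | u <- iota 0 v.-1.+1, s <- drops m' u]
  else [:: [::]].
Arguments drops : simpl never.

Lemma dropsS m v :
  drops m.+1 v = [seq u :: s | u <- iota 0 v.-1.+1, s <- drops m u].
Proof. by []. Qed.

Fixpoint profiles (m j : nat) : seq (seq nat) :=
  if m is m'.+1 then [seq j.+1 :: s | s <- profiles m' j] ++ drops m j.+1
  else [:: [::]].
Arguments profiles : simpl never.

Lemma profilesS m j :
  profiles m.+1 j = [seq j.+1 :: s | s <- profiles m j] ++ drops m.+1 j.+1.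
Proof. by []. Qed.

Lemma mem_drops m v s :
  (s \in drops m v) = (size s == m) && path (fun u w => w <= u.-1) v s.
Proof.
elim: m v s => [|m IHm] v [|x s] //; rewrite dropsS.
  by apply/negbTE/negP=> /allpairsPdep[u [t []]].
apply/idP/idP => [/allpairsPdep[u [t []]]|/and3P[szs xv ps]].
  by rewrite mem_iota IHm => uv /andP[szt pt] [-> ->]; apply/and3P; split=> //; lia.
apply/allpairsPdep; exists x, s; split=> //; first by rewrite mem_iota ltnS.
by rewrite IHm; apply/andP.
Qed.

Lemma path_step_below j u s :
  u <= j -> path (step j) u s = path (fun u w => w <= u.-1) u s.
Proof.
elim: s u => //= x s IHs u uj; rewrite /step uj subn1.
by case: leqP => //= xu; rewrite IHs //; lia.
Qed.

Lemma mem_profiles m j s : (s \in profiles m j) = profile m j s.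
Proof.
elim: m s => [|m IHm] s; first by rewrite inE /profile size_eq0; case: s.
rewrite profilesS mem_cat mem_drops /profile.
case: s => [|x s] /=; first by rewrite orbF; apply/mapP=> -[].
rewrite eqSS /step ltnn subn0.
case: (ltngtP x j.+1) => [xj|xj|->].
- rewrite ltnS in xj; rewrite path_step_below // xj.
  by case: mapP => // -[t _ [xE _]]; lia.
- rewrite [x <= j]leqNgt (ltnW xj) /= !andbF orbF.
  by apply/negbTE/negP=> /mapP[t _ []]; lia.
by rewrite ltnn andbF orbF mem_map ?IHm //= => ? ? [].
Qed.

Lemma drops_uniq m v : uniq (drops m v).
Proof.
elim: m v => [|m IHm] v //; rewrite dropsS.
apply: allpairs_uniq_dep => [|u _|]; [exact: iota_uniq | exact: IHm |].
by move=> [u s] [u' s'] _ _ /= [-> ->].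
Qed.

Lemma profiles_uniq m j : uniq (profiles m j).
Proof.
elim: m => [|m IHm] //.
rewrite profilesS cat_uniq drops_uniq andbT.
rewrite map_inj_uniq ?IHm => [|? ? []//] /=.
apply/hasPn=> -[|x s]; rewrite mem_drops //= => /and3P[_ xj _].
by apply/mapP=> -[t _ [xE _]]; lia.
Qed.

(** * Counting profiles *)

Lemma size_dropsS m v :
  size (drops m.+1 v) = \sum_(0 <= u < v.-1.+1) size (drops m u).
Proof. by rewrite dropsS size_allpairs_dep sumnE big_map /index_iota subn0. Qed.

Lemma size_drops_pascal m v :
  size (drops m.+1 v.+2) = size (drops m.+1 v.+1) + size (drops m v.+1).
Proof. by rewrite !size_dropsS big_nat_recr. Qed.

Lemma size_drops_le1 m v : v <= 1 -> size (drops m v) = 1.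
Proof.
elim: m v => // m IHm v v1; rewrite size_dropsS.
by have ->: v.-1 = 0 by [lia]; rewrite big_nat1 IHm.
Qed.

Lemma size_drops1 v : size (drops 1 v.+1) = v.+1.
Proof. by rewrite size_dropsS /= big_const_nat iter_addn; lia. Qed.

Lemma size_profilesS m j :
  size (profiles m.+1 j) = size (profiles m j) + size (drops m.+1 j.+1).
Proof. by rewrite profilesS size_cat size_map. Qed.

(** A first entry [j.+1] leaves a shorter profile, any other one a member of
    [drops]; both families satisfy the rule, so it follows by induction. *)
Lemma size_profiles_pascal m j :
  size (profiles m.+1 j.+1) = size (profiles m.+1 j) + size (profiles m j).
Proof.
elim: m => [|m IHm].
  by rewrite !size_profilesS !size_drops1 /=; lia.
rewrite size_profilesS IHm size_drops_pascal (size_profilesS m.+1).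
by have := size_profilesS m j; lia.
Qed.

Lemma size_profiles0 m : size (profiles m 0) = m.+1.
Proof.
by elim: m => // m IHm; rewrite size_profilesS IHm size_drops_le1 // addn1.
Qed.

Lemma antidiagonal_sumS (f : nat -> nat -> nat) N :
  \sum_(m < N.+1) f m (N - m) =
  f 0 N + \sum_(m < N) f m.+1 (N.-1 - m).
Proof.
rewrite big_ord_recl subn0; congr (_ + _); apply: eq_bigr => i _.
by rewrite lift0; congr f; lia.
Qed.

(** Pascal's rule adds two consecutive antidiagonals; the affine term
    [N + 4] accounts for their end terms [1] (for [m = 0]) and [N + 1] (for
    [m = N]), which the rule does not cover. *)
Lemma sum_size_profiles N :
  (\sum_(m < N.+1) size (profiles m (N - m))) + (N + 4) = Fibonacci (N + 5).
Proof.
pose T N := \sum_(m < N.+1) size (profiles m (N - m)).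
rewrite -/(T N).
have T_rec M : T M.+2 = T M.+1 + T M + (M + 3).
  have TS K : T K = 1 + \sum_(m < K) size (profiles m.+1 (K.-1 - m)).
    exact: (antidiagonal_sumS (fun m j => size (profiles m j))).
  rewrite [T M.+2]TS [T M.+1]TS big_ord_recr /= subnn size_profiles0.
  under eq_bigr => i _.
    rewrite (_ : M.+1 - i = (M - i).+1) ?size_profiles_pascal; last by have := ltn_ord i; lia.
  over.
  rewrite big_split /= -/(T M).
  lia.
have [] : T N + (N + 4) = Fibonacci (N + 5) /\
          T N.+1 + (N.+1 + 4) = Fibonacci (N.+1 + 5).
  elim: N => [|N [IH0 IH1]]; first by rewrite /T !big_ord_recr !big_ord0.
  split=> //; rewrite T_rec.
  have ->: Fibonacci (N.+2 + 5) = Fibonacci (N.+1 + 5) + Fibonacci (N + 5).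
    by rewrite !addSn.
  lia.
by [].
Qed.

Lemma count_drops_path_head m v x :
  count (path small_drop x) (drops m.+1 v) =
  \sum_(0 <= u < v.-1.+1) small_drop x u * count (path small_drop u) (drops m u).
Proof.
rewrite dropsS count_flatten sumnE !big_map /index_iota subn0.
apply: eq_bigr => u _; rewrite count_map /=.
case: (boolP (small_drop x u)) => /= xu; rewrite (mul1n, mul0n).
  by apply: eq_count => s /=; rewrite xu.
by rewrite -(count_pred0 (drops m u)); apply: eq_count => s /=; rewrite (negbTE xu).
Qed.

(** Below [v], a sequence with no drop of [2] or more must follow [v.-1, v.-2, ...] down
    to [0]. *)
Lemma count_drops_path m v : count (path small_drop v) (drops m v) = 1.
Proof.
elim: m v => // m IHm v; rewrite count_drops_path_head big_nat_recr //= IHm.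
rewrite big_nat_cond big1 /small_drop => [|u]; lia.
Qed.

Lemma count_drops_sorted m v : count (sorted small_drop) (drops m.+1 v.+1) = v.+1.
Proof.
rewrite dropsS count_flatten sumnE !big_map.
transitivity (\sum_(u <- iota 0 v.+1) 1).
  apply: eq_bigr => u _; rewrite count_map -[RHS](count_drops_path m u).
  exact: eq_count.
by rewrite sum1_size size_iota.
Qed.

(** The sequence is determined by the number of initial entries [j.+1], between
    [0] and [m]: the rest decreases one by one to [0]. *)
Lemma count_profiles_path m j : count (path small_drop j.+1) (profiles m j) = m.+1.
Proof.
elim: m => // m IHm.
rewrite profilesS count_cat count_drops_path.
rewrite count_map addn1 -[in RHS]IHm; congr _.+1; apply: eq_count => s /=.
by rewrite /small_drop leqnSn.
Qed.

Lemma count_profiles_sorted k j :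
  count (sorted small_drop) (profiles k.+1 j) = k + j + 2.
Proof.
rewrite profilesS count_cat count_drops_sorted.
rewrite count_map (eq_count (a2 := path small_drop j.+1)) // count_profiles_path.
lia.
Qed.

(** The profiles of games that distinguish their strong voters from their weak
    ones. *)
Definition strict_profiles (k j : nat) : seq (seq nat) :=
  [seq s <- profiles k.+1 j | ~~ sorted small_drop s].

Definition codes (n : nat) : seq (nat * seq nat) :=
  [seq (k, s) | k <- iota 0 n.+1, s <- strict_profiles k (n - k)].

Lemma codes_uniq n : uniq (codes n).
Proof.
apply: allpairs_uniq_dep => [|k _|]; first exact: iota_uniq.
  by rewrite filter_uniq // profiles_uniq.
by move=> [k s] [k' s'] _ _ /= [-> ->].
Qed.

Lemma mem_codes n k s :
  ((k, s) \in codes n) = [&& k <= n, profile k.+1 (n - k) s & ~~ sorted small_drop s].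
Proof.
apply/idP/and3P => [/allpairsPdep[k' [s' []]]|[kn ps ss]].
  by rewrite mem_iota mem_filter mem_profiles => ? /andP[? ?] [-> ->]; split.
by apply/allpairsPdep; exists k, s; rewrite mem_iota mem_filter mem_profiles ps ss; split.
Qed.

Lemma size_codes n : size (codes n) + (n ^ 2 + 4 * n + 8) = Fibonacci (n + 6).
Proof.
have := sum_size_profiles n.+1.
rewrite (addSnnS n 5) (antidiagonal_sumS (fun m j => size (profiles m j))).
rewrite [size (profiles 0 _)]/= [n.+1.-1]/=.
(* Each of the [n.+1] values of [k] loses its [n + 2] profiles without a large
   drop. *)
suff ->: \sum_(m < n.+1) size (profiles m.+1 (n - m)) = size (codes n) + n.+1 * (n + 2).
  by move=> <-; lia.
rewrite size_allpairs_dep sumnE big_map -[iota 0 n.+1]/(index_iota 0 n.+1) big_mkord.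
rewrite -[in n.+1 * _](card_ord n.+1) -sum_nat_const -big_split /=.
apply: eq_bigr => k _.
rewrite size_filter -(count_predC (sorted small_drop)) count_profiles_sorted.
by rewrite addnC; congr (_ + _); have := ltn_ord k; lia.
Qed.

(** * Coalitions *)

Lemma ex_subset_card (T : finType) (B : {set T}) m :
  m <= #|B| -> exists2 C : {set T}, C \subset B & #|C| = m.
Proof.
move=> mB; exists [set x in take m (enum B)].
  by apply/subsetP=> x; rewrite inE => /mem_take; rewrite mem_enum.
rewrite cardsE (card_uniqP _) ?take_uniq ?enum_uniq // size_takel //.
by rewrite -cardE.
Qed.

Lemma ex_coalition (T : finType) (A : {set T}) a b :
  a <= #|A| -> b <= #|~: A| ->
  exists U : {set T}, #|U :&: A| = a /\ #|U :\: A| = b.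
Proof.
move=> /ex_subset_card[C CA <-] /ex_subset_card[D DA <-].
have DA0: D :&: A = set0 by apply/eqP; rewrite setI_eq0 disjoints_subset.
exists (C :|: D); split.
  by rewrite setIUl (setIidPl CA) DA0 setU0.
rewrite setDUl [D :\: A]setDE (setIidPl DA).
by move: CA; rewrite -setD_eq0 => /eqP->; rewrite set0U.
Qed.

(** Written without subtraction, so that it covers the four cases for the
    membership of [i] and [j] in [B]. *)
Lemma card_swap (T : finType) (U B : {set T}) i j : j \in U -> i \notin U ->
  #|(i |: U :\ j) :&: B| + (j \in B) = #|U :&: B| + (i \in B).
Proof.
move=> jU iU.
rewrite (cardsD1 j (U :&: B)) (cardsD1 i (_ :&: B)) !inE eqxx jU /=.
suff ->: ((i |: U :\ j) :&: B) :\ i = (U :&: B) :\ j by lia.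
apply/setP=> x; rewrite !inE; case: (eqVneq x i) => [->|] /=.
  by rewrite (negbTE iU) andbF.
by rewrite andbA.
Qed.

Lemma card_swapD (T : finType) (U B : {set T}) i j : j \in U -> i \notin U ->
  #|(i |: U :\ j) :\: B| + (j \notin B) = #|U :\: B| + (i \notin B).
Proof. by move=> jU iU; rewrite ![_ :\: B]setDE -!in_setC card_swap. Qed.

(** Each element of [A] outside [B] is moved into [B] by a transposition. *)
Lemma ex_perm_imset (T : finType) (A B : {set T}) :
  #|A| = #|B| -> exists phi : {perm T}, phi @: A = B.
Proof.
have [d] := ubnP #|A :\: B|; elim: d A => // d IHd A ltd AB.
have [sAB|] := boolP (A \subset B).
  exists 1%g; have /eqP <- : A == B by rewrite eqEcard sAB AB leqnn.
  by rewrite -[RHS]imset_id; apply: eq_imset => x; rewrite perm1.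
case/subsetPn=> x xA xB.
have [y yB yA] : exists2 y, y \in B & y \notin A.
  apply/subsetPn; apply: contra xB => sBA.
  by have /eqP-> : B == A by rewrite eqEcard sBA AB leqnn.
have swapE : tperm x y @: A = y |: A :\ x.
  apply/setP=> z; rewrite -[z](tpermK x y) mem_imset; last exact: perm_inj.
  rewrite !inE tpermK; case: tpermP => [->|->|/eqP zx /eqP zy].
  - rewrite eqxx orbF (negbTE yA); apply/esym/negbTE.
    by apply: contraNneq yA => <-.
  - by rewrite eqxx xA.
  by rewrite (negbTE zx) (negbTE zy).
have [||phi phiB] := IHd (y |: A :\ x).
- by have := card_swapD B xA yA; rewrite xB yB; lia.
- by rewrite -AB; have := card_swap setT xA yA; rewrite !setIT !inE; lia.
exists (tperm x y * phi)%g; rewrite -phiB -swapE -imset_comp.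
by apply: eq_imset => z; rewrite permM.
Qed.

(** * Desirability in games with two classes *)

Lemma at_most_desirableP (T : finType) (chi : game T) i j :
  reflect (forall U : {set T}, j \in U -> i \notin U -> chi (i |: U :\ j) -> chi U)
          (at_most_desirable chi i j).
Proof.
have subC1 (U : {set T}) : (U \subset [set~ i]) = (i \notin U).
  by rewrite -disjoints_subset disjoint_sym disjoints1.
apply: (iffP forallP) => H U.
  move=> jU iU; move/(_ U): H; rewrite sub1set subC1 jU iU /=.
  by case: (chi U) (chi _) => [] [].
apply/implyP; rewrite sub1set subC1 => /andP[jU iU].
by move: (H U jU iU); case: (chi U) (chi _) => [] [] // /(_ isT).
Qed.

Lemma not_at_most_desirable (T : finType) (chi : game T) x y :
  ~~ at_most_desirable chi x y ->
  exists U : {set T}, [/\ y \in U, x \notin U, chi (x |: U :\ y) & ~~ chi U].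
Proof.
case/forallPn=> U; rewrite negb_imply sub1set => /andP[/andP[yU xU] win].
exists U; split=> //.
- by move: xU; rewrite -disjoints_subset disjoint_sym disjoints1.
- by case: (chi U) (chi _) win => [] [].
by case: (chi U) (chi _) win => [] [].
Qed.

Lemma simple_gameP (T : finType) (chi : game T) :
  reflect [/\ ~~ chi set0, chi setT
            & forall U V : {set T}, U \subset V -> chi U -> chi V]
          (simple_game chi).
Proof.
rewrite /simple_game eqbF_neg eqb_id.
apply: (iffP and3P) => -[chi0 chiT H]; split=> //.
  move=> U V UV; move/forallP/(_ U)/forallP/(_ V): H; rewrite UV /=.
  by case: (chi U) (chi V) => [] [].
apply/forallP=> U; apply/forallP=> V; apply/implyP=> /H.
by case: (chi U) (chi V) => [] [] // /(_ isT).
Qed.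

(** Exchange argument: as long as [U] is not contained in [V], a member of
    [U] outside [V] is replaced by a member of [V] outside [U] that is at least
    as desirable.  Strong members of [U] outside [V] are replaced first, by
    strong ones, which exist since [V] has at least as many strong members;
    then only weak voters leave, and anyone may replace them. *)
Lemma dominated_win (T : finType) (chi : game T) (A : {set T}) :
  (forall U V : {set T}, U \subset V -> chi U -> chi V) ->
  (forall x y, (x \in A) ==> (y \in A) -> at_most_desirable chi x y) ->
  forall U V : {set T}, #|U :&: A| <= #|V :&: A| -> #|U| <= #|V| -> chi U -> chi V.
Proof.
move=> mono des U V; have [d] := ubnP #|U :\: V|.
elim: d U => // d IHd U ltd UVA UV chiU.
have [/mono->//|nUV] := boolP (U \subset V).
have VU0 : 0 < #|V :\: U|.
  have := cardsID V U; have := cardsID U V; rewrite setIC.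
  have: 0 < #|U :\: V| by rewrite card_gt0 setD_eq0.
  by lia.
(* Exchanging such a pair makes [#|U :\: V|] smaller. *)
suff [i [j [iV iU jU jV [ij UVA']]]] : exists i j, [/\ i \in V, i \notin U, j \in U,
    j \notin V & (j \in A) ==> (i \in A) /\ #|(i |: U :\ j) :&: A| <= #|V :&: A| ].
  apply: (IHd (i |: U :\ j)) => //.
  - have := card_swapD V jU iU; rewrite iV jV; lia.
  - by have := card_swap setT jU iU; rewrite !setIT !inE; lia.
  have/at_most_desirableP := des j i ij; apply.
  - by rewrite setU11.
  - by rewrite !inE eqxx /= orbF; apply: contraNneq iU => <-.
  rewrite (_ : j |: _ :\ i = U) //; apply/setP=> x; rewrite !inE.
  case: (eqVneq x j) => [->|_] //=; case: (eqVneq x i) => [->|] //=.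
  by rewrite (negbTE iU).
(* All strong members of [U] lie in [V]: any member of [V] outside [U] may
   replace a weak one. *)
have [UAV|] := boolP (U :&: A \subset V).
  have [j jUV] : exists j, j \in U :\: V by apply/set0Pn; rewrite setD_eq0.
  have [i iVU] : exists i, i \in V :\: U by apply/set0Pn; rewrite -card_gt0.
  move: jUV iVU; rewrite !inE => /andP[jV jU] /andP[iU iV].
  have jA : j \notin A.
    by apply: contra jV => jA; rewrite (subsetP UAV) // inE jU.
  exists i, j; split=> //; rewrite (negbTE jA); split=> //.
  apply: subset_leq_card; apply/subsetP=> x; rewrite !inE.
  case: (eqVneq x i) => [->|_] /=; first by rewrite iV.
  by case/andP=> /andP[_ xU] xA; rewrite xA (subsetP UAV) // inE xU.
case/subsetPn=> j; rewrite inE => /andP[jU jA] jV.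
have /subsetPn[i] : ~~ (V :&: A \subset U :&: A).
  apply: contra jV => VUA.
  have /eqP VUA' : V :&: A == U :&: A by rewrite eqEcard VUA.
  have : j \in V :&: A by rewrite VUA' inE jU.
  by rewrite inE => /andP[].
rewrite !inE => /andP[iV iA]; rewrite iA andbT => iU.
exists i, j; split=> //; rewrite jA iA; split=> //.
by have := card_swap A jU iU; rewrite jA iA; lia.
Qed.

(** The voters that are not at the bottom of the desirability preorder.  With
    two classes this is the upper class; the definition refers to the game
    alone, so that isomorphisms preserve it. *)
Definition strong_voters (T : finType) (chi : game T) : {set T} :=
  [set x | [exists y, ~~ at_most_desirable chi x y]].

(** The classes are the fibres of [f] over its image. *)
Lemma card_voter_classes (T rT : finType) (chi : game T) (f : T -> rT) :
  (forall x y, equivalent_voters chi x y = (f x == f y)) ->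
  #|voter_classes chi| = #|[set f x | x : T]|.
Proof.
move=> E.
have ->: voter_classes chi = [set f @^-1: [set b] | b in [set f x | x : T]].
  rewrite -imset_comp; apply/setP=> C.
  have cls x : [set y in [set: T] | equivalent_voters chi x y] = f @^-1: [set f x].
    by apply/setP=> y; rewrite !inE E eq_sym.
  by apply/imsetP/imsetP=> -[x _ ->]; exists x; rewrite ?inE /= ?cls.
apply: card_in_imset => _ _ /imsetP[x _ ->] /imsetP[y _ ->] /setP/(_ x).
by rewrite !inE eqxx => /esym/eqP.
Qed.

Lemma complete_total_preorder (T : finType) (chi : game T) :
  complete_simple_game chi ->
  [/\ reflexive (at_most_desirable chi), transitive (at_most_desirable chi)
    & total (at_most_desirable chi)].
Proof.
case/andP=> _ /and3P[/forallP re /forallP tr /forallP to]; split=> //.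
  move=> y x z xy yz.
  by move/forallP/(_ y)/forallP/(_ z)/implyP/(_ xy)/implyP: (tr x); apply.
by move=> x y; move/forallP/(_ y): (to x).
Qed.

Lemma three_voter_classes (T : finType) (chi : game T) x y z :
  complete_simple_game chi ->
  ~~ at_most_desirable chi x y -> ~~ at_most_desirable chi y z ->
  2 < #|voter_classes chi|.
Proof.
move=> csg xy yz; have [re tr to] := complete_total_preorder csg.
have yx : at_most_desirable chi y x by case/orP: (to x y) xy => // ->.
have zy : at_most_desirable chi z y by case/orP: (to y z) yz => // ->.
have xz : ~~ at_most_desirable chi x z.
  by apply: contra xy => xz; apply: tr xz zy.
pose cls u := [set v in [set: T] | equivalent_voters chi u v].
have clsN u v : ~~ at_most_desirable chi u v -> cls u != cls v.
  move=> uv; apply: contra uv => /eqP/setP/(_ v).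
  by rewrite !inE /equivalent_voters re /= => /andP[].
have clsE u : cls u \in voter_classes chi by apply/imsetP; exists u; rewrite ?inE.
apply: (@leq_trans #|[set cls x; cls y; cls z]|).
  by rewrite -setUA !cardsU1 cards1 !inE negb_or !clsN.
by apply/subset_leq_card/subsetP=> C; rewrite !inE -orbA => /or3P[] /eqP->.
Qed.

Lemma exists_strong_weak (T : finType) (chi : game T) :
  complete_simple_game chi -> #|voter_classes chi| = 2 ->
  exists x y, ~~ at_most_desirable chi x y.
Proof.
move=> csg cl2.
suff: ~~ [forall x, forall y, at_most_desirable chi x y].
  by case/forallPn=> x /forallPn[y xy]; exists x, y.
apply/negP=> /forallP H.
have Hxy x y : at_most_desirable chi x y by have /forallP := H x.
move: cl2; rewrite (@card_voter_classes _ _ _ (fun=> tt)) => [cl2|x y].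
  by have := max_card [set tt | x : T]; rewrite cl2 card_unit.
by rewrite /equivalent_voters !Hxy.
Qed.

(** A strong voter [y] has some [z] strictly below it, so a voter [x] strictly
    above [y] would give three classes. *)
Lemma strong_voters_desirable (T : finType) (chi : game T) x y :
  complete_simple_game chi -> #|voter_classes chi| = 2 ->
  at_most_desirable chi x y = (x \in strong_voters chi) ==> (y \in strong_voters chi).
Proof.
move=> csg cl2; have [re tr to] := complete_total_preorder csg.
apply/idP/implyP=> [xy|H].
  rewrite !inE => /existsP[z xz]; apply/existsP; exists z.
  by apply: contra xz; apply: tr.
apply: contraT => xy.
have /H : x \in strong_voters chi by rewrite inE; apply/existsP; exists y.
rewrite inE => /existsP[z yz].
by have := three_voter_classes csg xy yz; rewrite cl2.
Qed.

(** * Games defined by profiles *)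

Lemma profileP m j s :
  reflect [/\ size s = m, forall a, a < m -> nth 0 s a <= j.+1
            & forall a, a.+1 < m -> step j (nth 0 s a) (nth 0 s a.+1)]
          (profile m j s).
Proof.
apply: (iffP andP) => [[/eqP sz /(pathP 0) ps]|[sz top st]].
  rewrite sz in ps; split=> // [a am|a am]; last exact: ps a.+1 am.
  elim: a am => [|a IHa] am; first by have := ps 0 am; rewrite /step /=; lia.
  by have := ps a.+1 am; have := IHa (ltnW am); rewrite /step /=; lia.
split; first exact/eqP.
apply/(pathP 0); rewrite sz => -[|a] am /=; last exact: st.
by have := top 0 am; rewrite /step; lia.
Qed.

(** A profile entry that is at most [j] decreases by at least one at each step
    until it vanishes, so one more strong voter saves at least one weak voter. *)
Lemma profile_dominated k j s a b a' b' : profile k.+1 j s ->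
  a <= a' -> a' <= k -> b <= j -> a + b <= a' + b' ->
  nth 0 s a <= b -> nth 0 s a' <= b'.
Proof.
case/profileP=> sz top st aa' a'k bj ab sab.
suff: nth 0 s a' <= nth 0 s a - (a' - a) by lia.
elim: a' aa' a'k {ab} => [|a' IHa] aa' a'k; first by have ->: a = 0 by [lia]; lia.
have [->|] := eqVneq a a'.+1; first lia.
by have := IHa; have := st a' a'k; rewrite /step; lia.
Qed.

Lemma exists_large_drop s : ~~ sorted small_drop s ->
  exists2 a, a.+1 < size s & (nth 0 s a.+1).+2 <= nth 0 s a.
Proof.
move=> ss.
have [/allP H|] := boolP (all (fun a => small_drop (nth 0 s a) (nth 0 s a.+1))
                           (iota 0 (size s).-1)).
  case/negP: ss; apply/(sortedP 0) => a sa; apply: H; rewrite mem_iota; lia.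
case/allPn=> a; rewrite mem_iota /small_drop => sa gap.
by exists a; lia.
Qed.

Definition profile_game (T : finType) (A : {set T}) (s : seq nat) : game T :=
  [ffun U => nth 0 s #|U :&: A| <= #|U :\: A|].

Lemma card_partsI (T : finType) (A U : {set T}) :
  [/\ #|U :&: A| + #|U :\: A| = #|U|, #|U :&: A| <= #|A| & #|U :\: A| <= #|~: A|].
Proof.
split; first exact: cardsID.
  by rewrite subset_leq_card ?subsetIr.
by rewrite subset_leq_card // setDE subsetIr.
Qed.

Lemma profile_game_mono (T : finType) (A : {set T}) s (U V : {set T}) :
  profile #|A|.+1 #|~: A| s ->
  #|U :&: A| <= #|V :&: A| -> #|U| <= #|V| ->
  profile_game A s U -> profile_game A s V.
Proof.
move=> ps UVA UV; rewrite !ffunE.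
have [UE Uk Uj] := card_partsI A U; have [VE Vk Vj] := card_partsI A V.
by apply: (profile_dominated ps) => //; lia.
Qed.

(** If [s_a >= s_(a + 1) + 2], a coalition of [a + 1] strong and [s_(a + 1)] weak
    voters wins, but loses once a strong member is replaced by a weak voter. *)
Lemma profile_game_desirable (T : finType) (A : {set T}) s x y :
  profile #|A|.+1 #|~: A| s -> ~~ sorted small_drop s ->
  at_most_desirable (profile_game A s) x y = (x \in A) ==> (y \in A).
Proof.
move=> ps ss; apply/idP/idP; last first.
  move=> xy; apply/at_most_desirableP=> U yU xU.
  apply: profile_game_mono => //.
    by have := card_swap A yU xU; move: xy; case: (x \in A) (y \in A) => [] []; lia.
  by have := card_swap setT yU xU; rewrite !setIT !inE; lia.
apply: contraTT; rewrite negb_imply => /andP[xA yA].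
have /profileP[sz top _] := ps.
have [a] := exists_large_drop ss; rewrite sz => ak gap.
have [C CA Ca] : exists2 C : {set T}, C \subset A :\ x & #|C| = a.
  by apply: ex_subset_card; have := cardsD1 x A; rewrite xA; lia.
have sa := top a (ltnW ak).
have [D DA Dc] : exists2 D : {set T}, D \subset ~: A :\ y & #|D| = nth 0 s a.+1.
  by apply: ex_subset_card; have := cardsD1 y (~: A); rewrite inE yA; lia.
(* [U] has [a] strong and [s_(a + 1) + 1] weak members, so it loses; with [x] in
   place of [y] it wins. *)
pose U := y |: (C :|: D).
have CP z : z \in C -> (z != x) && (z \in A) by move/(subsetP CA); rewrite !inE.
have DP z : z \in D -> (z != y) && (z \notin A) by move/(subsetP DA); rewrite !inE.
have yU : y \in U by rewrite setU11.
have xU : x \notin U.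
  rewrite !inE; apply/negP=> /or3P[/eqP xy|/CP|/DP]; rewrite ?eqxx ?xA ?andbF //.
  by rewrite xy (negbTE yA) in xA.
have UA : U :&: A = C.
  apply/setP=> z; rewrite !inE; case zC: (z \in C).
    by have /andP[_ ->] := CP z zC; rewrite orbT.
  case zD: (z \in D); first by have /andP[_ /negbTE->] := DP z zD; rewrite andbF.
  by case: eqVneq => [->|] //=; rewrite (negbTE yA).
have UD : U :\: A = y |: D.
  apply/setP=> z; rewrite !inE; case zD: (z \in D).
    by have /andP[_ ->] := DP z zD; rewrite !orbT.
  case zC: (z \in C); last by case: eqVneq => [->|] //=; rewrite ?yA ?andbF.
  have /andP[_ zA] := CP z zC; rewrite zA /= orbF; apply/esym/negbTE.
  by apply: contraNneq yA => <-.
have UDc : #|U :\: A| = (nth 0 s a.+1).+1.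
  by rewrite UD cardsU1 Dc; have := DP y; case: (y \in D) => // /(_ isT); rewrite eqxx.
apply/negP=> /at_most_desirableP/(_ U yU xU).
rewrite !ffunE UA Ca UDc.
have := card_swap A yU xU; have := card_swapD A yU xU.
rewrite UA Ca UDc xA (negbTE yA) => D1 D2.
have -> : #|(x |: U :\ y) :&: A| = a.+1 by lia.
by lia.
Qed.

Lemma strong_voters_profile_game (T : finType) (A : {set T}) s :
  profile #|A|.+1 #|~: A| s -> ~~ sorted small_drop s ->
  strong_voters (profile_game A s) = A.
Proof.
move=> ps ss; have /profileP[sz top _] := ps.
have [a] := exists_large_drop ss; rewrite sz => ak gap.
have [y yA] : exists y, y \in ~: A.
  by apply/set0Pn; rewrite -card_gt0; have := top a (ltnW ak); lia.
apply/setP=> x; rewrite inE; apply/existsP/idP => [[z]|xA].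
  by rewrite profile_game_desirable // negb_imply => /andP[].
exists y; rewrite profile_game_desirable // xA.
by rewrite inE in yA.
Qed.

Lemma profile_game_complete (T : finType) (A : {set T}) s :
  profile #|A|.+1 #|~: A| s -> ~~ sorted small_drop s ->
  complete_simple_game (profile_game A s) && (#|voter_classes (profile_game A s)| == 2).
Proof.
move=> ps ss; have /profileP[sz top _] := ps.
have [a] := exists_large_drop ss; rewrite sz => ak gap.
have sa := top a (ltnW ak).
have des := profile_game_desirable _ _ ps ss.
apply/andP; split; last first.
  rewrite (@card_voter_classes _ _ _ (fun x => x \in A)) => [|x y]; last first.
    by rewrite /equivalent_voters !des; case: (x \in A) (y \in A) => [] [].
  have [x xA] : exists x, x \in A by apply/set0Pn; rewrite -card_gt0; lia.
  have [y yA] : exists y, y \in ~: A by apply/set0Pn; rewrite -card_gt0; lia.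
  rewrite inE in yA.
  suff ->: [set x \in A | x : T] = [set: bool] by rewrite cardsT card_bool.
  apply/setP=> b; rewrite inE; apply/imsetP.
  by case: b; [exists x | exists y]; rewrite ?inE ?xA ?(negbTE yA).
apply/andP; split.
  apply/simple_gameP; split=> [||U V UV].
  - rewrite ffunE set0I set0D cards0 leqn0.
    (* If the empty coalition won, all entries would vanish. *)
    apply/negP=> s0.
    have := @profile_dominated _ _ _ 0 0 a 0 ps; lia.
  - rewrite ffunE setTI setTD.
    (* The entry below a large drop is at most [j], so that many weak voters
       exist and win with [a.+1] strong ones. *)
    by apply: (@profile_dominated _ _ _ a.+1 (nth 0 s a.+1) _ _ ps); lia.
  by apply: profile_game_mono => //; rewrite subset_leq_card // setSI.
apply/and3P; split.
- by apply/forallP=> x; rewrite des implybb.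
- apply/forallP=> x; apply/forallP=> y; apply/forallP=> z; rewrite !des.
  by case: (x \in A) (y \in A) (z \in A) => [] [] [].
- apply/forallP=> x; apply/forallP=> y; rewrite !des.
  by case: (x \in A) (y \in A) => [] [].
Qed.

(** The profile lists, for each number [a] of strong voters, the least number of
    weak voters that lets them win; by [dominated_win] the choice of the voters
    does not matter.  A strong voter that cannot be replaced by a weak one in
    some winning coalition yields a drop of at least [2]. *)
Lemma game_of_profile (T : finType) (chi : game T) (A := strong_voters chi) :
  complete_simple_game chi -> #|voter_classes chi| = 2 ->
  exists2 s, profile #|A|.+1 #|~: A| s && ~~ sorted small_drop s & chi = profile_game A s.
Proof.
move=> csg cl2.
have des x y := strong_voters_desirable x y csg cl2; rewrite -/A in des.
have [_ _ mono] : [/\ ~~ chi set0, chi setT &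
    forall U V : {set T}, U \subset V -> chi U -> chi V].
  by apply/simple_gameP; case/andP: csg.
have dom : forall U V : {set T},
    #|U :&: A| <= #|V :&: A| -> #|U| <= #|V| -> chi U -> chi V.
  by apply: dominated_win => // x y; rewrite des.
pose w a b := [exists U : {set T}, [&& #|U :&: A| == a, #|U :\: A| == b & chi U]].
pose t a := find (w a) (iota 0 #|~: A|.+1).
have t_top a : t a <= #|~: A|.+1 by rewrite -[X in _ <= X](size_iota 0) find_size.
have t_win a : t a <= #|~: A| -> w a (t a).
  move=> ta; have := @nth_find _ 0 (w a) (iota 0 #|~: A|.+1).
  by rewrite has_find size_iota -/(t a) nth_iota ?ltnS //; apply.
have winE U : chi U = (t #|U :&: A| <= #|U :\: A|).
  have [_ _ Uj] := card_partsI A U.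
  apply/idP/idP=> [chiU|/[dup] tU].
    rewrite leqNgt; apply/negP=> /[dup] lt /(before_find 0).
    rewrite nth_iota ?ltnS // => /negbT/negP[].
    by apply/existsP; exists U; rewrite !eqxx.
  move=> /leq_trans/(_ Uj)/t_win/existsP[V /and3P[/eqP VA /eqP VD]].
  have [VE _ _] := card_partsI A V; have [UE _ _] := card_partsI A U.
  by apply: dom; lia.
pose s := mkseq t #|A|.+1.
have sE a : a <= #|A| -> nth 0 s a = t a by move=> ak; rewrite nth_mkseq.
have chiE : chi = profile_game A s.
  apply/ffunP=> U; rewrite ffunE winE sE //.
  by have [] := card_partsI A U.
exists s => //; apply/andP; split.
  apply/profileP; split=> [|a ak|a ak]; first by rewrite size_mkseq.
    by rewrite sE.
  rewrite !sE //; last exact: ltnW.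
  rewrite /step.
  have [tj|] := leqP (t a) #|~: A|; last by rewrite subn0 => /(leq_trans (t_top _)).
  have /existsP[U /and3P[/eqP UA /eqP UD chiU]] := t_win a tj.
  (* Trading a weak voter, if there is one, for a strong one keeps [U] winning. *)
  have [V [VA VD]] : exists V : {set T}, #|V :&: A| = a.+1 /\ #|V :\: A| = t a - 1.
    by apply: ex_coalition; lia.
  rewrite -VA -VD -winE; apply: dom chiU; first by lia.
  have [VE _ _] := card_partsI A V; have [UE _ _] := card_partsI A U.
  by lia.
have [x [y xy]] := exists_strong_weak csg cl2.
have := xy; rewrite des negb_imply => /andP[xA yA].
have [U [yU xU]] := not_at_most_desirable xy.
rewrite !winE -ltnNge.
have := card_swap A yU xU; have := card_swapD A yU xU.
rewrite xA (negbTE yA).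
have [_ Uk _] := card_partsI A (x |: U :\ y).
move=> D2 D1 win lose; apply/negP=> sorted_s.
have /(sortedP 0)/(_ #|U :&: A|) := sorted_s.
rewrite size_mkseq /small_drop => H.
have E : #|(x |: U :\ y) :&: A| = #|U :&: A|.+1 by lia.
rewrite E in Uk win *.
have := H Uk; rewrite !sE ?(ltnW Uk) //; lia.
Qed.

(** * Isomorphism classes *)

Lemma isomorphic_gamesP (T : finType) (chi1 chi2 : game T) :
  reflect (exists phi : {perm T}, forall U : {set T}, chi1 U = chi2 (phi @: U))
          (isomorphic_games chi1 chi2).
Proof.
apply: (iffP existsP) => -[phi H]; exists phi; first by move=> U; apply/eqP/(forallP H).
by apply/forallP=> U; rewrite H.
Qed.

Lemma imset_permVK (T : finType) (phi : {perm T}) (U : {set T}) :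
  phi @: (phi^-1%g @: U) = U.
Proof. by rewrite -imset_comp -[RHS]imset_id; apply: eq_imset => x /=; rewrite permKV. Qed.

Lemma isomorphic_games_equivalence (T : finType) :
  equivalence_rel (@isomorphic_games T).
Proof.
have imp chi1 chi2 :
    @isomorphic_games T chi1 chi2 -> isomorphic_games chi2 chi1.
  move=> /isomorphic_gamesP[phi H]; apply/isomorphic_gamesP.
  by exists phi^-1%g => U; rewrite H imset_permVK.
have sym : symmetric (@isomorphic_games T).
  by move=> chi1 chi2; apply/idP/idP; apply: imp.
have tr : transitive (@isomorphic_games T).
  move=> chi2 chi1 chi3 /isomorphic_gamesP[phi H] /isomorphic_gamesP[psi K].
  apply/isomorphic_gamesP; exists (phi * psi)%g => U.
  by rewrite H K -imset_comp; congr (chi3 _); apply: eq_imset => x; rewrite permM.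
apply/equivalence_relP; split=> [chi|]; last exact: sym_left_transitive.
apply/isomorphic_gamesP; exists 1%g => U; congr (chi _).
by rewrite -[LHS]imset_id; apply: eq_imset => x; rewrite perm1.
Qed.

Lemma profile_game_imset (T : finType) (phi : {perm T}) (A U : {set T}) s :
  profile_game (phi @: A) s (phi @: U) = profile_game A s U.
Proof.
have mem_phi x (V : {set T}) : (phi x \in phi @: V) = (x \in V).
  by apply: mem_imset; apply: perm_inj.
have phiI : phi @: U :&: phi @: A = phi @: (U :&: A).
  by apply/setP=> x; rewrite -[x](permKV phi) !(inE, mem_phi).
have phiD : phi @: U :\: phi @: A = phi @: (U :\: A).
  by apply/setP=> x; rewrite -[x](permKV phi) !(inE, mem_phi).
by rewrite !ffunE phiI phiD !card_imset //; apply: perm_inj.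
Qed.

(** This makes the number of strong voters, and then the profile, an invariant
    of the isomorphism class. *)
Lemma strong_voters_iso (T : finType) (chi1 chi2 : game T) (phi : {perm T}) :
  (forall U : {set T}, chi1 U = chi2 (phi @: U)) ->
  strong_voters chi2 = phi @: strong_voters chi1.
Proof.
have swapE (psi : {perm T}) x y (U : {set T}) :
    psi @: (x |: U :\ y) = psi x |: (psi @: U) :\ psi y.
  apply/setP=> z; rewrite -[z](permKV psi) mem_imset; last exact: perm_inj.
  by rewrite !inE mem_imset ?(inj_eq perm_inj) //; apply: perm_inj.
have imp (psi : {perm T}) (c1 c2 : game T) x y :
    (forall U : {set T}, c1 U = c2 (psi @: U)) ->
    at_most_desirable c2 (psi x) (psi y) -> at_most_desirable c1 x y.
  move=> H /at_most_desirableP K; apply/at_most_desirableP=> U yU xU.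
  by rewrite !H swapE; apply: K; rewrite mem_imset //; apply: perm_inj.
move=> H; have HV U : chi2 U = chi1 (phi^-1%g @: U) by rewrite H imset_permVK.
have E x y : at_most_desirable chi2 (phi x) (phi y) = at_most_desirable chi1 x y.
  by apply/idP/idP; [apply: imp H | move=> xy; apply: imp HV _; rewrite !permK].
apply/setP=> z; rewrite -[z](permKV phi) mem_imset; last exact: perm_inj.
rewrite !inE; apply/existsP/existsP=> -[y]; last by exists (phi y); rewrite E.
by rewrite -[y](permKV phi) E; exists (phi^-1%g y).
Qed.

Definition first_voters n k : {set 'I_n} := [set i : 'I_n | i < k].

Lemma card_first_voters n k : k <= n -> #|first_voters n k| = k.
Proof.
move=> kn; rewrite -sum1_card.
under eq_bigl => i do rewrite inE.
by rewrite -(big_ord_widen n (fun=> 1) kn) sum1_card card_ord.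
Qed.

Lemma card_first_votersC n k : k <= n -> #|~: first_voters n k| = n - k.
Proof.
by move=> kn; have := cardsC (first_voters n k); rewrite card_first_voters // card_ord; lia.
Qed.

Definition code_game n (c : nat * seq nat) : game 'I_n :=
  profile_game (first_voters n c.1) c.2.

(** The isomorphism maps strong voters to strong voters, so it preserves the
    numbers of strong and of weak members of every coalition; testing all pairs
    of numbers recovers the profile. *)
Lemma code_game_inj n : {in codes n &, forall c d,
  isomorphic_games (code_game n c) (code_game n d) -> c = d}.
Proof.
move=> [k s] [l t]; rewrite !mem_codes => /and3P[kn ps ss] /and3P[ln pt st].
case/isomorphic_gamesP=> phi H.
have Ak := card_first_voters kn; have Al := card_first_voters ln.
have Bk := card_first_votersC kn; have Bl := card_first_votersC ln.
have AE : first_voters n l = phi @: first_voters n k.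
  have := strong_voters_iso H; rewrite !strong_voters_profile_game //=.
  - by rewrite Ak Bk.
  - by rewrite Al Bl.
have kl : k = l by rewrite -Ak -Al AE card_imset //; apply: perm_inj.
have E a b : a <= k -> b <= n - k -> (nth 0 s a <= b) = (nth 0 t a <= b).
  move=> ak bj; have [U [UA UD]] : exists U : {set 'I_n},
      #|U :&: first_voters n k| = a /\ #|U :\: first_voters n k| = b.
    by apply: ex_coalition; rewrite ?Ak ?Bk.
  by have := H U; rewrite /code_game /= AE profile_game_imset !ffunE UA UD.
subst l; congr (_, _).
have /profileP[szs tops _] := ps; have /profileP[szt topt _] := pt.
apply: (@eq_from_nth _ 0) => [|a]; rewrite szs ?szt // => ak.
have := tops a ak; have := topt a ak.
have := E a (nth 0 s a) ak; have := E a (nth 0 t a) ak.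
lia.
Qed.

Lemma code_game_surj n (chi : game 'I_n) :
  complete_simple_game chi -> #|voter_classes chi| = 2 ->
  exists2 c, c \in codes n & isomorphic_games chi (code_game n c).
Proof.
move=> csg cl2; have [s /andP[ps ss] ->] := game_of_profile csg cl2.
move: (strong_voters chi) ps => A ps.
have kn : #|A| <= n by rewrite -[X in _ <= X](card_ord n) max_card.
have jE : n - #|A| = #|~: A| by have := cardsC A; rewrite card_ord; lia.
exists (#|A|, s); first by rewrite mem_codes kn jE ps ss.
have [|phi AE] := @ex_perm_imset _ A (first_voters n #|A|).
  by rewrite card_first_voters.
apply/isomorphic_gamesP; exists phi => U.
by rewrite /code_game /= -AE profile_game_imset.
Qed.

(** Counting classes by a system of representatives [f c]. *)
Lemma card_equivalence_partition (T : finType) (C : eqType) (R : rel T) (D : {set T})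
    (cs : seq C) (f : C -> T) :
  equivalence_rel R -> uniq cs -> {in cs, forall c, f c \in D} ->
  {in cs &, forall c d, R (f c) (f d) -> c = d} ->
  {in D, forall x, exists2 c, c \in cs & R x (f c)} ->
  #|equivalence_partition R D| = size cs.
Proof.
move=> eqR ucs fD f_inj f_surj.
pose cls x := [set y in D | R x y].
have clsE x y : y \in D -> (cls x == cls y) = R x y.
  move=> yD; apply/eqP/idP=> [/setP/(_ y)|Rxy].
    by rewrite !inE yD (eqR y y y).1.
  by apply/setP=> z; rewrite !inE ((eqR x y z).2 Rxy).
rewrite -(size_map (cls \o f)) -(card_uniqP _); last first.
  rewrite map_inj_in_uniq // => c d cc dc /eqP /=.
  by rewrite clsE ?fD // => /f_inj; apply.
apply: eq_card => X; apply/imsetP/mapP=> [[x xD ->]|[c cc ->]].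
  have [c cc Rxc] := f_surj x xD; exists c => //.
  by apply/eqP; rewrite clsE ?fD.
by exists (f c); rewrite ?fD.
Qed.

Lemma cs2_codes n : cs n 2 = size (codes n).
Proof.
apply: (card_equivalence_partition (f := code_game n)).
- exact: isomorphic_games_equivalence.
- exact: codes_uniq.
- move=> [k s]; rewrite mem_codes inE => /and3P[kn ps ss].
  by apply: profile_game_complete; rewrite ?card_first_voters ?card_first_votersC.
- exact: code_game_inj.
move=> chi; rewrite inE => /andP[csg /eqP cl2].
exact: code_game_surj.
Qed.

Import GRing.Theory.
Local Open Scope ring_scope.

Theorem theorem4 (n : nat) (hn : (1 <= n)%N) :
  (cs n 2)%:Z = (Fibonacci (n + 6))%:Z - (n ^ 2 + 4 * n + 8)%N%:Z.
Proof. by rewrite cs2_codes -size_codes PoszD addrK. Qed.
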